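(* Let $Q$ be a restriction quantal frame with identity $e$. Then the space of identities of the étale category $\mathsf{C}(Q)$ (with the subspace topology) is homeomorphic to $\mathsf{pt}(e^{\downarrow})$, via $A\mapsto A\cap e^{\downarrow}$.
   Context: A restriction quantal frame is a frame $(Q,\le)$ with associative multiplication distributing over arbitrary joins on both sides, which is a monoid with identity $e$ and carries join-preserving unary operations $a\mapsto a^{\ast}$, $a\mapsto a^{+}$ with values in the set $e^{\downarrow}=\{x:x\le e\}$ of projections (a commutative subsemigroup of idempotents), fixing projections, with $aa^{\ast}=a$, $a^{+}a=a$, $(ab)^{\ast}=(a^{\ast}b)^{\ast}$, $(ab)^{+}=(ab^{+})^{+}$; the top element is a join of partial isometries ($a$ with $b\le a\Rightarrow b=b^{+}a=ab^{\ast}$) and partial isometries are closed under product. A completely prime filter (of a frame) is a nonempty upward closed subset closed under binary meets, not containing $0$, such that whenever $\bigvee_i a_i$ lies in it some $a_i$ does. $\mathsf{C}(Q)$ is the category of completely prime filters of $Q$ with $\mathbf{d}(A)=\{x:\exists a\in A,\ a^{\ast}\le x\}$, $\mathbf{r}(A)=\{x:\exists a\in A,\ a^{+}\le x\}$, $A\cdot B=\{x:\exists a\in A,b\in B,\ ab\le x\}$ defined iff $\mathbf{d}(A)=\mathbf{r}(B)$; its identities are the completely prime filters containing a projection. Its topology has base $\{\mathscr{X}_a: a \text{ a partial isometry}\}$, $\mathscr{X}_a=\{A:a\in A\}$. For a frame $F$, $\mathsf{pt}(F)$ is the set of completely prime filters of $F$ with topology $\{X_a:a\in F\}$, $X_a=\{P:a\in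 P\}$. *)

(* Defs.v *)
Set Implicit Arguments.

Definition img {A B : Type} (f : A -> B) (S : A -> Prop) : B -> Prop :=
  fun y => exists x, S x /\ y = f x.

Record RQF := {
  car :> Type;
  le : car -> car -> Prop;
  le_refl : forall a, le a a;
  le_trans : forall a b c, le a b -> le b c -> le a c;
  le_antisym : forall a b, le a b -> le b a -> a = b;
  join : (car -> Prop) -> car;
  join_ub : forall S x, S x -> le x (join S);
  join_least : forall S y, (forall x, S x -> le x y) -> le (join S) y;
  meet : car -> car -> car;
  meet_lb_l : forall a b, le (meet a b) a;
  meet_lb_r : forall a b, le (meet a b) b;
  meet_glb : forall a b c, le c a -> le c b -> le c (meet a b);
  meet_join_distr : forall a S, meet a (join S) = join (img (meet a) S);
  mul : car -> car -> car;
  e : car;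
  mul_assoc : forall a b c, mul a (mul b c) = mul (mul a b) c;
  mul_e_l : forall a, mul e a = a;
  mul_e_r : forall a, mul a e = a;
  mul_join_l : forall a S, mul a (join S) = join (img (mul a) S);
  mul_join_r : forall a S, mul (join S) a = join (img (fun x => mul x a) S);
  star : car -> car;
  plus : car -> car;
  star_join : forall S, star (join S) = join (img star S);
  plus_join : forall S, plus (join S) = join (img plus S);
  star_proj : forall a, le (star a) e;
  plus_proj : forall a, le (plus a) e;
  proj_mul_closed : forall x y, le x e -> le y e -> le (mul x y) e;
  proj_comm : forall x y, le x e -> le y e -> mul x y = mul y x;
  proj_idem : forall x, le x e -> mul x x = x;
  star_fix : forall x, le x e -> star x = x;
  plus_fix : forall x, le x e -> plus x = x;
  mul_star : forall a, mul a (star a) = a;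
  plus_mul_self : forall a, mul (plus a) a = a;
  star_mul : forall a b, star (mul a b) = star (mul (star a) b);
  plus_mul : forall a b, plus (mul a b) = plus (mul a (plus b));
  (* top is a join of partial isometries *)
  top_join_pisom : exists S : car -> Prop,
      (forall s, S s -> forall b, le b s -> b = mul (plus b) s /\ b = mul s (star b))
      /\ join S = join (fun _ => True);
  (* partial isometries are closed under product *)
  pisom_mul : forall a c,
      (forall b, le b a -> b = mul (plus b) a /\ b = mul a (star b)) ->
      (forall b, le b c -> b = mul (plus b) c /\ b = mul c (star b)) ->
      (forall b, le b (mul a c) -> b = mul (plus b) (mul a c) /\ b = mul (mul a c) (star b))
}.

Arguments le {r}. Arguments join {r}. Arguments meet {r}. Arguments mul {r}.
Arguments star {r}. Arguments plus {r}.

Section Defs.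
Variable Q : RQF.

Definition pisom (a : Q) : Prop :=
  forall b, le b a -> b = mul (plus b) a /\ b = mul a (star b).

Definition bot : Q := join (fun _ => False).

Definition cpf (A : Q -> Prop) : Prop :=
  (exists a, A a)
  /\ (forall a b, A a -> le a b -> A b)
  /\ (forall a b, A a -> A b -> A (meet a b))
  /\ ~ A bot
  /\ (forall S, A (join S) -> exists a, S a /\ A a).

(** completely prime filters of the frame e^down (joins, meets, bottom of e^down
    are those of Q), represented as subsets of Q contained in e^down. *)
Definition cpf_down (P : Q -> Prop) : Prop :=
  (forall x, P x -> le x (e Q))
  /\ (exists a, P a)
  /\ (forall a b, P a -> le a b -> le b (e Q) -> P b)
  /\ (forall a b, P a -> P b -> P (meet a b))
  /\ ~ P bot
  /\ (forall S, (forall x, S x -> le x (e Q)) -> P (join S) -> exists a, S a /\ P a).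

(** identities of C(Q): completely prime filters containing a projection *)
Definition C_identity (A : Q -> Prop) : Prop :=
  cpf A /\ exists x, le x (e Q) /\ A x.

(** opens of C(Q): unions of basic opens X_a = {A | a in A}, a partial isometry *)
Definition C_open (U : (Q -> Prop) -> Prop) : Prop :=
  forall A, U A -> cpf A /\ exists a, pisom a /\ A a /\ (forall B, cpf B -> B a -> U B).

Definition Id_open (W : (Q -> Prop) -> Prop) : Prop :=
  exists U, C_open U /\ forall A, W A <-> (U A /\ C_identity A).

Definition pt_open (V : (Q -> Prop) -> Prop) : Prop :=
  exists a, le a (e Q) /\ forall P, V P <-> (cpf_down P /\ P a).

Definition restr_e (A : Q -> Prop) : Q -> Prop := fun x => A x /\ le x (e Q).

End Defs.

Definition homeomorphism_via {X Y : Type}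
  (SX : X -> Prop) (OX : (X -> Prop) -> Prop)
  (SY : Y -> Prop) (OY : (Y -> Prop) -> Prop) (f : X -> Y) : Prop :=
  (forall x, SX x -> SY (f x))
  /\ (forall x y, SX x -> SX y -> f x = f y -> x = y)
  /\ (forall y, SY y -> exists x, SX x /\ f x = y)
  /\ (forall V, OY V -> OX (fun x => SX x /\ V (f x)))
  /\ (forall U, OX U -> OY (fun y => exists x, U x /\ SX x /\ f x = y)).

(* Main.v *)
(* A completely prime filter A of Q that contains a projection is generated by
   its projections: every x in A lies above the projection f ∧ x ∈ A, where f
   is any projection of A.  Hence A equals the upward closure of A ∩ e↓, so
   A ↦ A ∩ e↓ is injective.  Conversely the upward closure of a completely
   prime filter P of e↓ is a completely prime filter of Q (complete primeness
   uses meet-over-join distributivity) whose trace on e↓ is P, so the map is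
   onto.  For continuity, the preimage of X_a (a ≤ e) is the trace of the
   basic open 𝒳_a, a projection being a partial isometry.  For openness, an
   open set W of identities is sent to X_t, where t is the join of all
   projections p such that every identity containing p lies in W; complete
   primeness of the filters of e↓ shows that a point contains t exactly when
   it contains one of these p. *)

Require Import Defs.
From Stdlib Require Import FunctionalExtensionality PropExtensionality.

Section RestrictionQuantalFrame.
Variable Q : RQF.

Lemma pred_ext (A B : Q -> Prop) : (forall x, A x <-> B x) -> A = B.
Proof.
  intro H. apply functional_extensionality. intro x.
  apply propositional_extensionality. apply H.
Qed.

Lemma bot_le (x : Q) : le (bot Q) x.
Proof. unfold bot. apply join_least. intros ? []. Qed.

Lemma meet_absorb (p x : Q) : le p x -> meet p x = p.
Proof.
  intro lpx. apply le_antisym.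
  - apply meet_lb_l.
  - apply meet_glb; [apply le_refl | exact lpx].
Qed.

(* Left multiplication is monotone, since it preserves binary joins. *)
Lemma mul_mono_r (z x y : Q) : le x y -> le (mul z x) (mul z y).
Proof.
  intro lxy.
  assert (Hy : y = join (fun t => t = x \/ t = y)).
  { apply le_antisym.
    - apply join_ub. auto.
    - apply join_least. intros t [-> | ->]; [exact lxy | apply le_refl]. }
  rewrite Hy, mul_join_l. apply join_ub. exists x. auto.
Qed.

(* Every projection is a partial isometry: below a projection a, b = b a. *)
Lemma proj_pisom (a : Q) : le a (e Q) -> pisom Q a.
Proof.
  intros la b lb. assert (lbe : le b (e Q)) by (eapply le_trans; eauto).
  assert (Hba : mul b a = b).
  { apply le_antisym.
    - rewrite <- (mul_e_r Q b) at 2. apply mul_mono_r. exact la.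
    - rewrite <- (proj_idem Q b lbe) at 1. apply mul_mono_r. exact lb. }
  rewrite (plus_fix Q b lbe), (star_fix Q b lbe). split; [auto|].
  rewrite proj_comm; auto.
Qed.

Definition up (P : Q -> Prop) : Q -> Prop := fun x => exists p, P p /\ le p x.

Lemma identity_generated (A : Q -> Prop) (x : Q) :
  C_identity Q A -> A x -> exists p, restr_e Q A p /\ le p x.
Proof.
  intros [(_ & _ & A_meet & _ & _) [f [lf Af]]] Ax.
  exists (meet f x). split; [split|apply meet_lb_r].
  - apply A_meet; assumption.
  - eapply le_trans; [apply meet_lb_l | exact lf].
Qed.

Lemma identity_up_restr (A : Q -> Prop) :
  C_identity Q A -> A = up (restr_e Q A).
Proof.
  intro IA. apply pred_ext. intro x. split.
  - apply identity_generated, IA.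
  - destruct IA as [(_ & A_up & _) _]. intros [p [[Ap _] lpx]]. eauto.
Qed.

Lemma restr_cpf_down (A : Q -> Prop) :
  C_identity Q A -> cpf_down Q (restr_e Q A).
Proof.
  intros [(_ & A_up & A_meet & A_bot & A_prime) [f [lf Af]]].
  unfold restr_e. split; [|split; [|split; [|split; [|split]]]].
  - intros x []. assumption.
  - exists f. auto.
  - intros a b [Aa _] lab lb. split; eauto.
  - intros a b [Aa la] [Ab _]. split; [apply A_meet; assumption|].
    eapply le_trans; [apply meet_lb_l | exact la].
  - intros [Abot _]. exact (A_bot Abot).
  - intros S S_proj [AS _]. destruct (A_prime S AS) as [s [Ss As]].
    exists s. split; [exact Ss | split; [exact As | apply S_proj, Ss]].
Qed.

Section UpwardClosure.
Variable P : Q -> Prop.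
Hypothesis HP : cpf_down Q P.

Lemma up_cpf : cpf Q (up P).
Proof.
  destruct HP as (P_proj & [a Pa] & P_up & P_meet & P_bot & P_prime).
  repeat split.
  - exists a, a. split; [exact Pa | apply le_refl].
  - intros x y [p [Pp lpx]] lxy. exists p. split; [exact Pp | eapply le_trans; eauto].
  - intros x y [p [Pp lpx]] [q [Pq lqy]]. exists (meet p q). split; [auto|].
    apply meet_glb.
    + eapply le_trans; [apply meet_lb_l | exact lpx].
    + eapply le_trans; [apply meet_lb_r | exact lqy].
  - intros [p [Pp lp]]. apply P_bot. apply (P_up p); auto. apply bot_le.
  - (* p ≤ ⋁S gives p = ⋁(p ∧ s), and P is completely prime on e↓ *)
    intros S [p [Pp lp]].
    assert (Hp : p = join (img (meet p) S)).
    { rewrite <- meet_join_distr. symmetry. apply meet_absorb, lp. }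
    destruct (P_prime (img (meet p) S)) as [b [[s [Ss ->]] Pb]].
    + intros x [s [_ ->]]. eapply le_trans; [apply meet_lb_l | apply P_proj, Pp].
    + rewrite <- Hp. exact Pp.
    + exists s. split; [exact Ss|]. exists (meet p s). split; [exact Pb | apply meet_lb_r].
Qed.

Lemma up_identity : C_identity Q (up P).
Proof.
  split; [exact up_cpf|].
  destruct HP as (P_proj & [a Pa] & _).
  exists a. split; [apply P_proj, Pa|]. exists a. split; [exact Pa | apply le_refl].
Qed.

Lemma restr_up : restr_e Q (up P) = P.
Proof.
  destruct HP as (_ & _ & P_up & _).
  apply pred_ext. intro x. unfold restr_e, up. split.
  - intros [[p [Pp lpx]] lx]. apply (P_up p); assumption.
  - intro Px. split; [exists x; split; [exact Px | apply le_refl]|].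
    destruct HP as (P_proj & _). apply P_proj, Px.
Qed.

End UpwardClosure.

Lemma preimage_pt_open (V : (Q -> Prop) -> Prop) :
  pt_open Q V -> Id_open Q (fun A => C_identity Q A /\ V (restr_e Q A)).
Proof.
  intros [a [la HV]].
  exists (fun A => cpf Q A /\ A a). split.
  - intros A [cA Aa]. split; [exact cA|].
    exists a. split; [apply proj_pisom, la|]. split; [exact Aa|].
    intros B cB Ba. split; assumption.
  - intro A. split.
    + intros [IA VA]. apply HV in VA as [_ [Aa _]].
      split; [split; [apply IA | exact Aa] | exact IA].
    + intros [[_ Aa] IA]. split; [exact IA|].
      apply HV. split; [apply restr_cpf_down, IA | split; [exact Aa | exact la]].
Qed.

(* The projections p such that every identity containing p lies in U; their
   join t determines the image of the trace of U, which is X_t. *)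
Definition inner_proj (U : (Q -> Prop) -> Prop) (p : Q) : Prop :=
  le p (e Q) /\ forall B, C_identity Q B -> B p -> U B.

Lemma inner_join_proj (U : (Q -> Prop) -> Prop) : le (join (inner_proj U)) (e Q).
Proof. apply join_least. intros x []. assumption. Qed.

(* An identity in an open U has a projection in [inner_proj U]: below the
   partial isometry witnessing openness, within the identity. *)
Lemma open_identity_inner (U : (Q -> Prop) -> Prop) (A : Q -> Prop) :
  C_open Q U -> U A -> C_identity Q A -> exists p, restr_e Q A p /\ inner_proj U p.
Proof.
  intros CU UA IA.
  destruct (CU A UA) as [_ [b [_ [Ab Ub]]]].
  destruct (identity_generated A b IA Ab) as [p [[Ap lpe] lpb]].
  exists p. split; [split; assumption|]. split; [exact lpe|].
  intros B [cB _] Bp. apply Ub; [exact cB|].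
  destruct cB as (_ & B_up & _). eauto.
Qed.

Lemma image_Id_open (W : (Q -> Prop) -> Prop) :
  Id_open Q W ->
  pt_open Q (fun P => exists A, W A /\ C_identity Q A /\ restr_e Q A = P).
Proof.
  intros [U [CU HW]].
  exists (join (inner_proj U)). split; [apply inner_join_proj|].
  intro P. split.
  - intros [A [WA [IA <-]]]. split; [apply restr_cpf_down, IA|].
    apply HW in WA as [UA _].
    destruct (open_identity_inner _ _ CU UA IA) as [p [[Ap _] Hp]].
    split; [|apply inner_join_proj].
    destruct IA as [(_ & A_up & _) _]. apply (A_up p); [exact Ap|].
    apply join_ub, Hp.
  - intros [HP Pt].
    pose proof HP as (_ & _ & _ & _ & _ & P_prime).
    destruct (P_prime (inner_proj U)) as [p [[_ Up] Pp]];
      [intros x []; assumption | exact Pt |].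
    exists (up P). split; [|split; [apply up_identity, HP | apply restr_up, HP]].
    apply HW. split; [|apply up_identity, HP].
    apply Up; [apply up_identity, HP|]. exists p. split; [exact Pp | apply le_refl].
Qed.

End RestrictionQuantalFrame.

Theorem mainTheorem11 (Q : RQF) :
  homeomorphism_via (@C_identity Q) (@Id_open Q)
                    (@cpf_down Q) (@pt_open Q) (@restr_e Q).
Proof.
  split; [exact (@restr_cpf_down Q)|].
  split.
  { intros A B IA IB Heq.
    rewrite (identity_up_restr _ _ IA), (identity_up_restr _ _ IB), Heq. reflexivity. }
  split.
  { intros P HP. exists (up Q P). split; [apply up_identity | apply restr_up]; exact HP. }
  split; [exact (@preimage_pt_open Q) | exact (@image_Id_open Q)].
Qed.
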